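(* Consider a vertex-fault-tolerant labeling scheme $(L_0,L_1)$ for $n$-vertex graphs, where $L_i$ assigns $b_i$-bit labels to the vertices ($i\in\{0,1\}$). Suppose that given $L_0(s)$, $L_0(t)$ and $\{L_1(v)\mid v\in F\}$, where $|F|\le f$, the scheme reports whether $s,t$ are connected in $G-F$. Then either $b_0=\Omega(f)$ or $b_1=\Omega(n)$.
   Context: A labeling scheme $(L_0,L_1)$ assigns, for every $n$-vertex undirected graph $G=(V,E)$, to each vertex $v\in V$ a $b_0$-bit label $L_0(v)$ and a $b_1$-bit label $L_1(v)$, and has a query algorithm that, seeing only the listed labels (and not $G$), answers every query $\langle s,t,F\rangle$ with $s,t\in V\setminus F$, $F\subseteq V$, $|F|\le f$. $G-F$ is the subgraph induced by $V\setminus F$. The conclusion is to be read as: there is an absolute constant $c>0$ such that $b_0\ge cf$ or $b_1\ge cn$.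
   Formalization: The formal theorem assumes f < n; for larger f no further queries arise (s is not in F, so |F| < n), and the claim as worded fails, e.g. for n = f = 1 with b_0 = b_1 = 0, or for f ≥ n^3 with large n and L_0 storing the whole graph. *)

(* Defs.v *)
From HB Require Import structures.
From mathcomp Require Import all_boot all_order all_algebra.

Set Implicit Arguments.
Unset Strict Implicit.
Unset Printing Implicit Defensive.

Record sgraph (V : finType) := SGraph {
  adj : rel V;
  adj_sym : symmetric adj;
  adj_irr : irreflexive adj
}.

Definition vdel (V : finType) (G : sgraph V) (F : {set V}) :
    sgraph {v : V | v \notin F} :=
  SGraph (adj := fun x y => adj G (val x) (val y))
    (fun x y => adj_sym G (val x) (val y)) (fun x => adj_irr G (val x)).

Definition connected_in (V : finType) (G : sgraph V) (s t : V) : bool :=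
  connect (adj G) s t.

(* [decode] is independent of the graph: it is given two L_0 labels and a list
   of L_1 labels only.  It may depend on n, b0 and b1. *)
Record labeling_scheme (n b0 b1 : nat) := LabelingScheme {
  label0 : sgraph 'I_n -> 'I_n -> b0.-tuple bool;
  label1 : sgraph 'I_n -> 'I_n -> b1.-tuple bool;
  decode : b0.-tuple bool -> b0.-tuple bool -> seq (b1.-tuple bool) -> bool
}.

(* The labels of F are handed over in an arbitrary order [ls], so that [decode]
   cannot extract information from an enumeration order of the vertices.
   Multiplicities are kept; a decoder that only uses the set of labels is the
   particular case where [decode] factors through the set of members of [ls]. *)
Definition answers_queries (n b0 b1 f : nat) (S : labeling_scheme n b0 b1) :
    Prop :=
  forall (G : sgraph 'I_n) (F : {set 'I_n}), #|F| <= f ->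
  forall (s t : {v : 'I_n | v \notin F}) (ls : seq (b1.-tuple bool)),
    perm_eq ls [seq label1 S G v | v <- enum F] ->
    decode S (label0 S G (val s)) (label0 S G (val t)) ls
      = connected_in (vdel G F) s t.

(* Main.v *)
(** If [B] is a set of [k <= f + 1] vertices and [A] is the set of the others,
    deleting [B] minus one vertex [b] from a bipartite graph between [A] and [B]
    leaves [a] in [A] connected to [b] iff [a] and [b] are adjacent. Hence the
    [L_0] labels of all vertices and the [L_1] labels of [B] determine the
    graph, and [k (n - k) <= n b0 + k b1]. Taking [k] about [f / 2] makes both
    [n - k >= n / 2] and [f <= 2 k]. *)
Require Import Defs.
From HB Require Import structures.
From mathcomp Require Import all_boot all_order all_algebra.
From mathcomp Require Import zify lra.
Import Order.TTheory GRing.Theory Num.Theory.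

Set Implicit Arguments.
Unset Strict Implicit.
Unset Printing Implicit Defensive.

(** As [s != t], a path has a first edge, and that edge can only lead to [t]. *)
Lemma connected_vdel_unique_neighbour (V : finType) (G : sgraph V)
    (F : {set V}) (s t : {v : V | v \notin F}) :
  s != t -> (forall x, x \notin F -> adj G (val s) x -> x = val t) ->
  connected_in (vdel G F) s t = adj G (val s) (val t).
Proof.
move=> neq_st nbr_s; apply/idP/idP => [|st]; last exact: connect1.
case/connectP=> -[|x p] /= => [_ ts|/andP[sx _] _].
  by rewrite ts eqxx in neq_st.
by rewrite -(nbr_s _ (valP x) sx).
Qed.

Section BipartiteGraph.
Variables k m : nat.
Implicit Type M : {ffun 'I_k * 'I_m -> bool}.

(** The left summand ['I_k] plays the role of [B], the right summand ['I_m] that of [A]; [M] is the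
    biadjacency matrix. *)
Definition bip_adj M : rel 'I_(k + m) := fun u v =>
  match split u, split v with
  | inl b, inr a | inr a, inl b => M (b, a)
  | _, _ => false
  end.

Lemma bip_adj_sym M : symmetric (bip_adj M).
Proof. by move=> u v; rewrite /bip_adj; case: (split u); case: (split v). Qed.

Lemma bip_adj_irr M : irreflexive (bip_adj M).
Proof. by move=> u; rewrite /bip_adj; case: (split u). Qed.

Definition bip_graph M := SGraph (bip_adj_sym M) (bip_adj_irr M).

Definition left_but (b : 'I_k) : {set 'I_(k + m)} :=
  [set lshift m i | i in [set~ b]].

Lemma card_left_but b : #|left_but b| = k.-1.
Proof. by rewrite card_imset ?cardsC1 ?card_ord //; exact: lshift_inj. Qed.

Lemma lshift_left_but b i : (lshift m i \in left_but b) = (i != b).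
Proof. by rewrite mem_imset ?in_setC1 //; exact: lshift_inj. Qed.

Lemma rshift_left_but b (a : 'I_m) : rshift k a \notin left_but b.
Proof. by apply/imsetP => -[i _ /eqP]; rewrite eq_rlshift. Qed.

Lemma connected_bip_graph M b a
    (s t : {v : 'I_(k + m) | v \notin left_but b}) :
  val s = rshift k a -> val t = lshift m b ->
  connected_in (vdel (bip_graph M) (left_but b)) s t = M (b, a).
Proof.
move=> s_a t_b; rewrite connected_vdel_unique_neighbour.
- by rewrite s_a t_b /= /bip_adj (unsplitK (inl b)) (unsplitK (inr a)).
- by rewrite -val_eqE s_a t_b eq_rlshift.
move=> x; rewrite s_a t_b /= /bip_adj (unsplitK (inr a)).
case: (split_ordP x) => // i -> + _.
by rewrite lshift_left_but negbK => /eqP->.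
Qed.

End BipartiteGraph.

Lemma labels_bound (k m f b0 b1 : nat) (S : labeling_scheme (k + m) b0 b1) :
  k.-1 <= f -> answers_queries f S -> k * m <= (k + m) * b0 + k * b1.
Proof.
move=> le_kf Sok.
pose enc (M : {ffun 'I_k * 'I_m -> bool}) :=
  ([ffun v => label0 S (bip_graph M) v],
   [ffun i => label1 S (bip_graph M) (lshift m i)])
  : {ffun 'I_(k + m) -> b0.-tuple bool} * {ffun 'I_k -> b1.-tuple bool}.
have enc_inj : injective enc.
  move=> M M' [/ffunP eq0 /ffunP eq1]; apply/ffunP => -[b a].
  have b_ok : lshift m b \notin left_but m b by rewrite lshift_left_but eqxx.
  pose s := exist (fun v => v \notin left_but m b) _ (rshift_left_but b a).
  pose t := exist (fun v => v \notin left_but m b) _ b_ok.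
  have le_F : #|left_but m b| <= f by rewrite card_left_but.
  rewrite -!(@connected_bip_graph _ _ _ b a s t) //.
  (* Both entries become decoder outputs, with the labels of the faults listed in the same order for
     [M] and [M']. *)
  rewrite -!(Sok _ _ le_F s t _ (perm_refl _)).
  have := eq0 (val s); have := eq0 (val t); rewrite !ffunE => -> ->.
  (* All faults lie in [B], the only place where [enc] records [L_1] labels. *)
  congr decode; apply/eq_in_map => v; rewrite mem_enum => /imsetP[i _ ->].
  by have := eq1 i; rewrite !ffunE.
have := leq_card enc enc_inj.
rewrite card_prod !card_ffun card_prod !card_tuple card_bool !card_ord.
by rewrite -!expnM -expnD leq_exp2l // [b0 * _]mulnC [b1 * _]mulnC.
Qed.

Local Open Scope ring_scope.

Theorem theorem9p1 :
  exists c : rat, 0 < c /\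
    forall (n f b0 b1 : nat) (S : labeling_scheme n b0 b1),
      (f < n)%N -> answers_queries f S ->
      c * f%:R <= b0%:R \/ c * n%:R <= b1%:R.
Proof.
exists (1 / 6%:R); split=> [//|n f b0 b1 S lt_fn Sok].
have [le_f|lt_f] := leqP f (6 * b0).
  by left; move: le_f; rewrite -(ler_nat rat) natrM; lra.
have [le_n|lt_n] := leqP n (6 * b1).
  by right; move: le_n; rewrite -(ler_nat rat) natrM; lra.
exfalso; set k := uphalf f.
have [m n_km] : exists m, n = (k + m)%N by exists (n - k)%N; rewrite /k; lia.
move: S Sok; rewrite n_km => S Sok.
have le_kf : (k.-1 <= f)%N by rewrite /k; lia.
have := labels_bound le_kf Sok.
(* Rounding up is harmless: [2 k <= f + 1 <= n]. *)
have le_km : (k <= m)%N by move: n_km; rewrite /k; lia.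
have lt_b0 : (3 * b0 < k)%N by rewrite /k; lia.
(* The constant 6 suffices: since [k + m <= 2 m], the term [(k + m) b0] is below [2 k m / 3] and
   [k b1] is below [k (k + m) / 6 <= k m / 3], so the sum falls short of [k m]. *)
rewrite n_km in lt_n; nia.
Qed.
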